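(* Let $E$ be a quojection, so that $E$ is the strict projective limit of a sequence of Banach spaces $(E_n)_n$ (with surjective canonical projections $P_n:E\to E_n$). Then $E$ is an Asplund space if and only if each $E_n$ is an Asplund space; and $E$ is a weak Asplund space if and only if each $E_n$ is a weak Asplund space.
   Context: All vector spaces are real; all topological vector spaces are Hausdorff; ''lcs'' means locally convex space. A lcs $E$ is Asplund (respectively weak Asplund) if every continuous convex function $f:D\to\mathbb{R}$, where $D\subset E$ is a nonempty open convex set, is Fréchet (respectively Gâteaux) differentiable on a dense $G_\delta$ subset of $D$. Here $f$ is Gâteaux differentiable at $x\in D$ if there is $x^*\in E'$ with $\lim_{t\to0}\frac{f(x+ty)-f(x)}{t}=x^*(y)$ for every $y\in E$, and Fréchet differentiable at $x$ if moreover the limit is uniform for $y$ in each bounded subset of $E$. Let $(E_n)_n$ be a sequence of Banach spaces and, for $m\ge n$, let $P_{nm}:E_m\to E_n$ be continuous linear maps with $P_{nn}$ the identity and $P_{nm}\circ P_{ms}=P_{ns}$ for $s\ge m\ge n$. The projective limit is $E=\{(x(n))\in\prod_nE_n: P_{nm}(x(m))=x(n),\ m\ge n\}$ with the product topology, and the canonical projections are $P_n:E\to E_n$, $(x(m))_m\mapsto x(n)$. $E$ is a strict projective limit of $(E_n)_n$ if each $P_n$ is surjective. A quojection is a Fréchet space (metrizable and complete lcs) that is the strict projective limit of such a sequence of Banach spaces. *)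

(* Defs.v *)
From HB Require Import structures.
From mathcomp Require Import all_boot all_order all_algebra.
From mathcomp Require Import all_classical all_reals all_analysis.
From mathcomp Require Import borel_hierarchy.

Set Implicit Arguments.
Unset Strict Implicit.
Unset Printing Implicit Defensive.

Import Order.TTheory GRing.Theory Num.Theory.
Import numFieldTopology.Exports numFieldNormedType.Exports.

Local Open Scope classical_set_scope.
Local Open Scope ring_scope.

Section Asplund.
Context {R : realType} {E : tvsType R}.

Definition tvs_bounded (B : set E) : Prop :=
  forall U : set E, nbhs 0 U ->
    exists2 r : R, 0 < r & forall t : R, r < t -> B `<=` ( *:%R t @` U).

Definition gateaux_derivative (f : E -> R^o) (x : E)
    (xs : {linear E -> R^o}) : Prop :=
  continuous xs /\
  forall y : E, (f (x + t *: y) - f x) / t @[t --> (0 : R)^'] --> xs y.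

Definition gateaux_differentiable (f : E -> R^o) (x : E) : Prop :=
  exists xs : {linear E -> R^o}, gateaux_derivative f x xs.

Definition frechet_differentiable (f : E -> R^o) (x : E) : Prop :=
  exists xs : {linear E -> R^o},
    gateaux_derivative f x xs /\
    forall B : set E, tvs_bounded B -> forall e : R, 0 < e ->
      \forall t \near (0 : R)^',
        forall y : E, B y -> `|(f (x + t *: y) - f x) / t - xs y| < e.

(* A function on D is represented by a total function, constrained on D only;
   as D is open, the derivatives at a point of D do not depend on the values
   taken outside D, and a subset of D is G_delta in D iff it is in E. *)
Definition generically_in (diff : (E -> R^o) -> E -> Prop) : Prop :=
  forall (D : set E) (f : E -> R^o),
    D !=set0 -> open D -> convex_set D ->
    {within D, continuous f} -> convex_function D f ->
    exists G : set E,
      [/\ G `<=` D, Gdelta G, D `<=` closure G & forall x, G x -> diff f x].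

End Asplund.

Definition asplund {R : realType} (E : tvsType R) : Prop :=
  generically_in (@frechet_differentiable R E).

Definition weak_asplund {R : realType} (E : tvsType R) : Prop :=
  generically_in (@gateaux_differentiable R E).

Section Frechet_space.
Context {R : realType} (E : tvsType R).

Definition metrizable : Prop :=
  exists d : E -> E -> R,
    [/\ forall x y, d x y = 0 <-> x = y,
        forall x y, d x y = d y x,
        forall x y z, d x z <= d x y + d y z &
        forall (x : E) (A : set E),
          nbhs x A <-> exists2 e : R, 0 < e & [set y | d x y < e] `<=` A].

(* [tvsType] does not require its entourages to be translation invariant, so
   completeness is stated for the uniformity of the additive group of E. *)
Definition tvs_cauchy (F : set_system E) : Prop :=
  forall U : set E, nbhs 0 U ->
    exists2 A : set E, F A & forall x y, A x -> A y -> U (x - y).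

Definition tvs_complete : Prop :=
  forall F : set_system E, ProperFilter F -> tvs_cauchy F ->
    exists x : E, F --> x.

(* A [tvsType] is locally convex; Hausdorff follows from metrizability. *)
Definition frechet_space : Prop := metrizable /\ tvs_complete.

End Frechet_space.

Section Projective_limit.
Context {R : realType} (F : nat -> completeNormedModType R).
(* [P n m] maps [F m] to [F n]; it is unconstrained, and unused, for m < n. *)
Variable P : forall n m : nat, {linear F m -> F n}.

Definition projective_system : Prop :=
  [/\ forall n m, (n <= m)%N -> continuous (P n m),
      forall n x, P n n x = x &
      forall n m s, (n <= m)%N -> (m <= s)%N ->
        forall x, P n m (P m s x) = P n s x].

Definition threads : set (prod_topology F) :=
  [set x | forall n m, (n <= m)%N -> P n m (x m) = x n].

(* E is identified with [threads], a subspace of the product, through the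
   linear map with components [p]; its components are then the canonical
   projections. *)
Definition projective_limit (E : tvsType R)
    (p : forall n, {linear E -> F n}) : Prop :=
  let iota : E -> prod_topology F := fun x n => p n x in
  [/\ injective iota,
      range iota = threads &
      forall A : set E, open A <->
        exists2 B : set (prod_topology F), open B & A = iota @^-1` B].

Definition strict_projective_limit (E : tvsType R)
    (p : forall n, {linear E -> F n}) : Prop :=
  projective_limit p /\ forall n, range (p n) = setT.

End Projective_limit.

(* Main.v *)
(* A continuous convex function on an open subset of E is bounded above near
   every point, hence on a set of the form p_n^-1(V) with V a ball. Such a set
   contains whole translates of ker p_n, on which a convex function bounded
   above is constant, so locally f = g o p_n with g convex and continuous on V.
   The projections p_n are open and lift bounded sets to bounded sets (open
   mapping theorem for the P_{m,m+1}, lifting one coordinate at a time), so f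
   is differentiable at x if and only if g is differentiable at p_n(x). It
   remains to transport dense G_delta sets. Preimages under an open continuous
   map are immediate, and generic properties can be checked locally. For images,
   the set of Gateaux differentiability points need not be a G_delta, so a
   Banach-Mazur game argument is used: if the preimage of S under an open
   continuous surjection from a completely metrizable space to a Baire space
   contains a dense G_delta set, then S contains one as well. *)

Require Import Defs.
From HB Require Import structures.
From mathcomp Require Import all_boot all_order all_algebra.
From mathcomp Require Import all_classical all_reals all_analysis.
From mathcomp Require Import borel_hierarchy ring lra.

Set Implicit Arguments.
Unset Strict Implicit.
Unset Printing Implicit Defensive.

Import Order.TTheory GRing.Theory Num.Theory.
Import numFieldTopology.Exports numFieldNormedType.Exports.

Local Open Scope classical_set_scope.
Local Open Scope ring_scope.

(** * Generic sets *)

(** Otherwise [i] could be added to [A], against maximality. Density of unions is obtained this way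
    below. *)
Lemma maximal_disjoint_meets (I T : Type) (F : I -> set T) (A B : set I) (i : I) :
  maximal_disjoint_subcollection F A B -> B i -> F i !=set0 ->
  exists2 j, A j & F i `&` F j !=set0.
Proof.
move=> [AB tA maxA] Bi Fi0; apply: contrapT => noj.
have disj j : A j -> F i `&` F j !=set0 -> False by move=> Aj ?; apply: noj; exists j.
have nAi : ~ A i by move=> Ai; apply: (disj i) => //; rewrite setIid.
apply: (maxA (i |` A)).
- split; first by move=> j Aj; right.
  by move=> /(_ i (or_introl erefl)).
- by move=> j [-> //|/AB].
- move=> j k [-> |Aj] [-> |Ak] //.
  + by move=> /disj; case.
  + by rewrite setIC => /disj; case.
  + exact: tA.
Qed.

Section generic.
Context {T : topologicalType}.
Implicit Types D S U : set T.

Definition generic D S := exists G : set T,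
  [/\ G `<=` D, Gdelta G, D `<=` closure G & G `<=` S].

Lemma generic_setI_open D S U : open U -> generic D S -> generic (D `&` U) S.
Proof.
move=> oU [G [GD [ O oO GO] DG GS]]; subst G.
exists (\bigcap_i O i `&` U); split.
- by move=> x [Gx Ux]; split=> //; exact: GD.
- exists (fun i => O i `&` U); first by move=> i; exact: openI.
  rewrite eqEsubset; split => x; first by move=> [Ox Ux] i _; split => //; exact: Ox.
  by move=> Ox; split; [move=> i _; case: (Ox i I)|case: (Ox 0%N I)].
- move=> x [Dx Ux] N Nx.
  have [] := DG _ Dx (N `&` U); first by apply: filterI => //; exact: open_nbhs_nbhs.
  by move=> y [Gy [Ny Uy]]; exists y.
- by move=> x [/GS].
Qed.

(* A maximal disjoint family of open sets on which [S] is generic has a dense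
   union, and along a disjoint family countable intersections commute with
   the union. *)
Lemma generic_local D S :
  (forall x, D x -> exists W, [/\ open W, W x, W `<=` D & generic W S]) ->
  generic D S.
Proof.
move=> locD.
have [E maxE] := ex_maximal_disjoint_subcollection (@id (set T))
  [set W | [/\ open W, W `<=` D & generic W S]].
have [EC tE _] := maxE.
have /choice[ O OE] W : exists O : (set T)^nat, E W -> [/\ forall k, open (O k),
    \bigcap_k O k `<=` W, W `<=` closure (\bigcap_k O k) & \bigcap_k O k `<=` S].
  case: (pselect (E W)) => [/EC[_ _ [G [GD [ O oO GO] DG GS]]]|nEW].
    by subst G; exists O.
  by exists (fun=> set0).
pose A k := \bigcup_(W in E) (W `&` O W k).
have GE W x : E W -> W x -> (\bigcap_k A k) x <-> (\bigcap_k O W k) x.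
  move=> EW Wx; split=> [Ax k _|Ox k _]; last by exists W => //; split => //; exact: Ox.
  have [W' EW' [W'x OW'x]] := Ax k I.
  by have <- : W' = W by apply: tE => //; exists x.
exists (\bigcap_k A k); split.
- by move=> x /(_ 0%N I) [W /EC[_ WD _] [Wx _]]; exact: WD.
- exists A => // k; apply: bigcup_open => W EW; apply: openI; first by case: (EC _ EW).
  by case: (OE _ EW).
- move=> x Dx N; rewrite nbhsE => -[N' [oN' N'x] N'N].
  have [W [oW Wx WD gW]] := locD _ Dx.
  have [||W' EW' [z [[Wz N'z] W'z]]] := @maximal_disjoint_meets _ _ _ _ _ (W `&` N') maxE.
  + split; [exact: openI|by move=> y [/WD]|exact: generic_setI_open].
  + by exists x.
  have [_ OW' W'O _] := OE _ EW'.
  have [|y [Oy N'y]] := W'O z W'z N'; first exact: open_nbhs_nbhs.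
  by exists y; split; [apply/(GE W') => //; exact: OW'|exact: N'N].
- move=> x Ax; have [W EW [Wx _]] := Ax 0%N I.
  by have [_ _ _] := OE _ EW; apply; apply/(GE W).
Qed.

End generic.

(** Density survives because an open map sends a neighbourhood of [x] to one of [p x], which meets
    the dense set. *)
Lemma generic_preimage (X Y : topologicalType) (p : X -> Y) (D S : set Y) :
  continuous p -> (forall U, open U -> open (p @` U)) ->
  generic D S -> generic (p @^-1` D) (p @^-1` S).
Proof.
move=> cp op [G [GD [ O oO GO] DG GS]]; subst G.
exists (p @^-1` (\bigcap_k O k)); split.
- by move=> x; exact: GD.
- exists (fun k => p @^-1` O k); last by rewrite preimage_bigcap.
  by move=> k; apply: open_comp.
- move=> x Dx N; rewrite nbhsE => -[N' [oN' N'x] N'N].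
  have [|y [Gy [z N'z zy]]] := DG _ Dx (p @` N').
    by apply: open_nbhs_nbhs; split; [exact: op|exists x].
  by exists z; split; [rewrite /= zy|exact: N'N].
- by move=> x; exact: GS.
Qed.

(* An abstract form of complete metrizability: a set in [small k] has to be
   thought of as a set of diameter at most 1 / k. *)
Definition complete_sieve (X : topologicalType) (small : nat -> set (set X)) :=
  (forall k W x, open W -> W x ->
    exists U, [/\ open U, U x, closure U `<=` W & small k U]) /\
  (forall u : nat -> set X, (forall k, small k (u k)) -> (forall k, u k !=set0) ->
    (forall k, closure (u k.+1) `<=` u k) ->
    exists2 x, (forall k, u k x) & forall N, nbhs x N -> exists k, u k `<=` N).

(** * Images of generic sets under open continuous maps *)

Section generic_image.
Context {X Y : topologicalType} (p : X -> Y) (small : nat -> set (set X)).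
Hypotheses (cp : continuous p) (op : forall U, open U -> open (p @` U)).
Hypothesis sieve : complete_sieve small.
Variable D : set Y.
Hypothesis oD : open D.

(** [good] is the invariant kept at every stage of the game and [refine] is one move; disjoint
    images leave at most one member over a given point of [Y]. *)
Let good (F : set (set X)) := [/\ forall U, F U -> open U,
  forall U, F U -> U `<=` p @^-1` D & D `<=` closure (\bigcup_(U in F) p @` U)].

Let refine (k : nat) (A : set X) (F F' : set (set X)) :=
  [/\ trivIset F' (fun U => p @` U), forall U, F' U -> small k U,
      forall U, F' U -> U !=set0 &
      forall U, F' U -> exists2 V, F V & closure U `<=` V `&` A].

(** Take a maximal family of candidates with disjoint images. Every open set meeting [D] contains
    the image of a candidate, so by maximality it meets the image of a member. *)
Let refine_ex k A F : open A -> p @^-1` D `<=` closure A -> good F ->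
  exists F', good F' /\ refine k A F F'.
Proof.
move=> oA DA [oF FD DF].
pose C := [set U : set X | [/\ open U, U !=set0, small k U &
  exists2 V, F V & closure U `<=` V `&` A]].
have [F' maxF'] := ex_maximal_disjoint_subcollection (fun U => p @` U) C.
have [F'C tF' _] := maxF'.
exists F'; split; [split|split] => //.
- by move=> U /F'C[].
- move=> U /F'C[_ _ _ [V /FD VD clU]] x Ux; apply: VD.
  by have [] := clU _ (subset_closure Ux).
- move=> y Dy N; rewrite nbhsE => -[N' [oN' N'y] N'N].
  have [|_ [[V FV [x Vx <-]] [N'x Dx]]] := DF _ Dy (N' `&` D).
    by apply: open_nbhs_nbhs; split => //; exact: openI.
  have oVN : open (V `&` p @^-1` N').
    by apply: openI; [exact: oF|exact: open_comp].
  have [|z [Az [Vz N'z]]] := DA x Dx (V `&` p @^-1` N').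
    exact: open_nbhs_nbhs.
  have [||U [oU Uz clU sU]] := sieve.1 k (V `&` p @^-1` N' `&` A) z.
  + exact: openI.
  + by [].
  have [||U' F'U' [w [[u Uu uw] [u' U'u' u'w]]]] := maximal_disjoint_meets (i := U) maxF'.
  + split => //; first by exists z.
    by exists V => // t /clU[[]].
  + by exists (p z); exists z.
  exists w; split; first by exists U' => //; exists u'.
  by apply: N'N; rewrite -uw; have [[]] := clU _ (subset_closure Uu).
- by move=> U /F'C[].
- by move=> U /F'C[].
- by move=> U /F'C[].
Qed.

(* The refining families of sets with disjoint images form a winning strategy in
   the Banach-Mazur game on [Y]; a point of [Y] surviving at every stage comes
   with a decreasing sequence of small sets shrinking to a preimage. *)
Lemma generic_image (S : set Y) :
  hausdorff_space Y ->
  (forall O : (set Y)^nat, (forall i, open (O i) /\ dense (O i)) ->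
    dense (\bigcap_i O i)) ->
  (forall y, exists x, p x = y) ->
  generic (p @^-1` D) (p @^-1` S) -> generic D S.
Proof.
move=> hY baireY surj [G [GD [A oA GA] DG GS]]; subst G.
have DA k : p @^-1` D `<=` closure (A k).
  by move=> x /DG; apply: closureS; exact: bigcap_inf.
have /choice[next nextP] (s : nat * set (set X)) :
    exists F', good s.2 -> good F' /\ refine s.1 (A s.1) s.2 F'.
  have [gs|] := pselect (good s.2); last by exists set0.
  by have [F' ?] := refine_ex s.1 (oA s.1) (DA s.1) gs; exists F'.
pose fam := fix fam k := if k is k'.+1 then next (k', fam k') else [set p @^-1` D].
have gfam k : good (fam k).
  elim: k => [|k /(nextP (k, _))[]//]; split.
  - by move=> _ ->; exact: open_comp.
  - by move=> _ ->.
  - move=> y Dy; apply: subset_closure; exists (p @^-1` D) => //.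
    by have [x xy] := surj y; exists x => //=; rewrite xy.
have rfam k : refine k (A k) (fam k) (fam k.+1) by have [] := nextP (k, _) (gfam k).
pose W k := \bigcup_(U in fam k.+1) p @` U.
have oW k : open (W k).
  by apply: bigcup_open => U FU; apply: op; have [oF _ _] := gfam k.+1; exact: oF.
exists (D `&` \bigcap_k W k); split.
- by move=> y [].
- exists (fun k => D `&` W k); first by move=> k; exact: openI.
  rewrite eqEsubset; split => y; first by move=> [Dy Wy] k _; split => //; exact: Wy.
  by move=> DWy; split; [case: (DWy 0%N I)|move=> k _; case: (DWy k I)].
- move=> y Dy N; rewrite nbhsE => -[N' [oN' N'y] N'N].
  (* [W k] is dense in [D] only; adding the exterior of [D] makes it dense in [Y], as the Baire
     property requires. *)
  have := baireY (fun k => W k `|` ~` closure D) _ (D `&` N').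
  case.
  + move=> k; split; first by apply: openU => //; rewrite openC; exact: closed_closure.
    move=> U [z Uz] oU; have [[t [Ut Dt]]|nUD] := pselect (U `&` D !=set0).
      have [_ _ DW] := gfam k.+1.
      have [|v [Wv [Uv _]]] := DW _ Dt (U `&` D).
        by apply: open_nbhs_nbhs; split=> //; exact: openI.
      by exists v; split=> //; left.
    exists z; split=> //; right => clDz.
    have [|v [Dv Uv]] := clDz U; first exact: open_nbhs_nbhs.
    by apply: nUD; exists v.
  + by exists y.
  + exact: openI.
  + move=> z [[Dz N'z] Oz]; exists z; split; last exact: N'N.
    split=> // k _; have [//|nclD] := Oz k I.
    by exfalso; apply: nclD; exact: subset_closure.
move=> y [Dy Wy].
have /choice[u uP] k : exists U, fam k.+1 U /\ (p @` U) y.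
  by have [U ? ?] := Wy k I; exists U.
have clu k : closure (u k.+1) `<=` u k `&` A k.+1.
  have [_ _ _ /(_ _ (uP k.+1).1)[V FV clV]] := rfam k.+1.
  (* The [u k] were chosen independently of each other. The images of [u k] and [V] share the point
     [y], so disjointness of images identifies them and the sequence is nested. *)
  suff -> : u k = V by [].
  have [tF _ _ _] := rfam k; apply: tF => //; first exact: (uP k).1.
  exists y; split; first exact: (uP k).2.
  have [x ux <-] := (uP k.+1).2; exists x => //.
  by have [] := clV _ (subset_closure ux).
have [x ux cvgx] : exists2 x, (forall k, u k x) & forall N, nbhs x N -> exists k, u k `<=` N.
  apply: sieve.2.
  - by move=> k; have [_ sF _ _] := rfam k; apply: sF; exact: (uP k).1.
  - by move=> k; have [x ? _] := (uP k).2; exists x.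
  - by move=> k z /clu[].
(* Every neighbourhood of [p x] contains the image of some [u k], hence [y]. *)
have pxy : p x = y.
  apply: hY => M N Mx Ny.
  have [k ukM] := cvgx _ (cp Mx).
  have [z uz zy] := (uP k).2; exists y; split; last exact: nbhs_singleton.
  by rewrite -zy; exact: ukM.
rewrite -pxy; apply: GS => k _.
have [_ _ _ /(_ _ (uP k).1)[V _ clV]] := rfam k.
by have [] := clV _ (subset_closure (ux k)).
Qed.

End generic_image.
(** * The open mapping theorem *)

Section open_mapping.
Context {R : realType} {V W : completeNormedModType R} (T : {linear V -> W}).
Hypotheses (cT : continuous T) (surjT : forall y, exists x, T x = y).

(** By Baire, the closure of the image of some ball contains a ball; differences of points recentre
    it at 0, and homogeneity extends the estimate to every [y]. *)
Let almost_onto : exists2 K : R, 0 < K & forall (y : W) (e : R), 0 < e ->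
  exists2 x : V, `|x| <= K * `|y| & `|y - T x| < e.
Proof.
pose C k := closure (T @` [set x | `|x| <= k%:R]).
have [k ndk] : exists k, ~ dense (~` C k).
  apply/existsNP => dC.
  have [|||y [_ Cy]] := @Baire _ W (fun k => ~` C k) _ setT.
  - by move=> k; split=> //; rewrite openC; exact: closed_closure.
  - by exists 0.
  - exact: openT.
  have [x Txy] := surjT y.
  apply: (Cy (Num.truncn `|x|).+1 I); apply: subset_closure; exists x => //=.
  by rewrite ltW// truncnS_gt.
have [U [[y0 [oU Uy0]] UC]] := denseNE ndk.
have {oU Uy0} /nbhs_ballP[r r0 rU] : nbhs y0 U by exact: open_nbhs_nbhs.
have {UC rU} Cr z : `|z| < r -> C k (y0 + z).
  move=> zr; have Uz : U (y0 + z).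
    by apply: rU; rewrite -ball_normE /ball_/= opprD addrA subrr sub0r normrN.
  by apply: contrapT => nC; have : set0 (y0 + z) by rewrite -UC.
have near_r (z : W) (e : R) : 0 < e -> `|z| < r ->
    exists2 x : V, `|x| <= k%:R + k%:R & `|z - T x| < e.
  move=> e0 zr; have e20 : 0 < e / 2 by rewrite divr_gt0.
  have [_ [[a ak <-]]] := Cr _ zr _ (nbhsx_ballx (y0 + z) (e / 2) e20).
  rewrite -ball_normE /ball_/= => za.
  have := Cr 0; rewrite normr0 addr0 => /(_ r0 _ (nbhsx_ballx y0 (e / 2) e20)).
  move=> [_ [[b bk <-]]]; rewrite -ball_normE /ball_/= => zb.
  exists (a - b); first by rewrite (le_trans (ler_normB _ _))// lerD.
  have -> : z - T (a - b) = (y0 + z - T a) - (y0 - T b).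
    rewrite linearB !opprB [y0 + z]addrC -!addrA; congr (_ + _).
    by rewrite [- T a + _]addrA [RHS]addrCA subrr addr0 addrC.
  by rewrite (le_lt_trans (ler_normB _ _))// [ltRHS]splitr ltrD.
(* [y] is rescaled to norm [r / 2], where [near_r] gives an approximate solution of norm at most
   [k + k]; the extra 1 keeps the constant positive when [k] is 0. *)
exists ((k%:R + k%:R + 1) * 2 / r) => [|y e e0].
  by rewrite divr_gt0// mulr_gt0// ltr_wpDl//.
have [->|yn0] := eqVneq y 0.
  exists 0; first by rewrite !normr0 mulr0.
  by rewrite linear0 subr0 normr0.
have y0' : 0 < `|y| by rewrite normr_gt0.
pose c := r / 2 / `|y|; have c0 : 0 < c by rewrite !divr_gt0.
have [||x xk xy] := near_r (c *: y) (c * e).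
- by rewrite mulr_gt0.
- by rewrite normrZ gtr0_norm// /c divfK ?gt_eqF// ltr_pdivrMr// ltr_pMr// ltr1n.
exists (c^-1 *: x).
  rewrite normrZ gtr0_norm ?invr_gt0// ler_pdivrMl//.
  rewrite (_ : c * _ = k%:R + k%:R + 1); first by rewrite (le_trans xk)// lerDl.
  by rewrite /c; field; rewrite !gt_eqF.
rewrite -(ltr_pM2l c0) -[X in X * `|_|](gtr0_norm c0) -normrZ scalerBr [T _]linearZ/=.
by rewrite scalerA divff ?gt_eqF// scale1r.
Qed.

(** Solve approximately, then again for the remainder: remainders halve, so the corrections form an
    absolutely convergent series. Summing the ratio 1/2 costs a factor 2. *)
Lemma open_mapping : exists2 K : R, 0 < K &
  forall y, exists2 x, T x = y & `|x| <= K * `|y|.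
Proof.
have [K K0 approx] := almost_onto.
have /choice[phi phiP] (y : W) : exists x, `|x| <= K * `|y| /\ `|y - T x| <= `|y| / 2.
  have [->|yn0] := eqVneq y 0.
    by exists 0; rewrite linear0 subr0 !normr0 mulr0 mul0r.
  have [|x xK /ltW xy] := approx y (`|y| / 2); first by rewrite divr_gt0 ?normr_gt0.
  by exists x.
exists (K * 2) => [|y]; first by rewrite mulr_gt0.
pose r := fix r n := if n is n'.+1 then r n' - T (phi (r n')) else y.
have rE n : `|r n| <= `|y| * 2^-1 ^+ n.
  elim: n => [|n IHn]; first by rewrite expr0 mulr1.
  by rewrite (le_trans (phiP _).2)// exprSr mulrA ler_pM2r.
pose x n := phi (r n).
have xE n : `|x n| <= geometric (K * `|y|) 2^-1 n.
  by rewrite (le_trans (phiP _).1)//= -mulrA ler_pM2l.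
have half1 : `|2^-1 : R| < 1 by rewrite ger0_norm// invf_lt1// ltr1n.
have cg := @cvg_geometric_series R (K * `|y|) 2^-1 half1.
have cx : cvgn [normed series x].
  apply: (series_le_cvg _ _ xE) => //; last exact: cvgP cg.
  by move=> n; rewrite geometric_ge0 // mulr_ge0// ltW.
have TxE n : T (series x n) = y - r n.
  elim: n => [|n IHn]; first by rewrite /series/= big_geq// linear0 subrr.
  by rewrite seriesSr linearD IHn /= opprB [RHS]addrA [RHS]addrAC.
have r0 : r @ \oo --> 0.
  apply: norm_cvg0; apply: (squeeze_cvgr _ _ (cvg_geometric `|y| half1)); last exact: cvg_cst.
  by apply: nearW => n; rewrite normr_ge0 /= rE.
exists (limn (series x)).
  have : T (series x n) @[n --> \oo] --> T (limn (series x)).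
    by apply: (cvg_comp _ _ (normed_cvg cx)); exact: cT.
  move=> /(cvg_lim (@norm_hausdorff _ _)) <-.
  apply/cvg_lim; first exact: norm_hausdorff.
  under eq_fun do rewrite TxE.
  by have := cvgB (cvg_cst y) r0; rewrite subr0; exact.
rewrite (le_trans (lim_series_norm cx))//.
have -> : K * 2 * `|y| = K * `|y| * (1 - 2^-1)^-1 by field.
rewrite -(cvg_lim _ cg)//; apply: ler_lim => //; first exact: cvgP cg.
by apply: nearW => n; apply: ler_sum => i _; exact: xE.
Qed.

End open_mapping.
(** * Strict projective limits of Banach spaces *)

Lemma continuous_linear_norm_le (R : realType) (V W : normedModType R)
    (f : {linear V -> W}) :
  continuous f -> exists2 K : R, 0 < K & forall x, `|f x| <= K * `|x|.
Proof.
by move=> /linear_bounded_continuous/linear_boundedP/pinfty_ex_gt0[K K0 fK]; exists K.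
Qed.

Section quojection.
Context {R : realType} {E : tvsType R} {F : nat -> completeNormedModType R}.
Context {P : forall n m : nat, {linear F m -> F n}}.
Context {p : forall n : nat, {linear E -> F n}}.
Hypotheses (hP : projective_system P) (hEP : strict_projective_limit P p).

Lemma strict_limit_thread n m x : (n <= m)%N -> P n m (p m x) = p n x.
Proof.
have [[_ rp _] _] := hEP; move: n m.
by have : threads P (fun n => p n x) by rewrite -rp; exists x.
Qed.

Lemma strict_limit_ex (z : forall n, F n) :
  (forall n m, (n <= m)%N -> P n m (z m) = z n) -> exists x, forall n, p n x = z n.
Proof.
have [[_ rp _] _] := hEP; move=> zP.
have : threads P z by [].
by rewrite -rp => -[x _ <-]; exists x.
Qed.

Lemma strict_limit_surj n y : exists x, p n x = y.
Proof.
have [_ /(_ n) rp] := hEP.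
have : [set: F n] y by [].
by rewrite -rp => -[x _ <-]; exists x.
Qed.

Lemma strict_limit_continuous n : continuous (p n).
Proof.
apply/continuousP => A oA; have [[_ _ topE] _] := hEP; apply/topE.
exists (@proj nat F n @^-1` A) => //.
by apply: open_comp => // z _; exact: proj_continuous.
Qed.

Let norm_le n m : (n <= m)%N ->
  exists2 K : R, 0 < K & forall x, `|p n x| <= K * `|p m x|.
Proof.
move=> nm; have [cP _ _] := hP.
have [K K0 PK] := continuous_linear_norm_le (cP _ _ nm).
by exists K => // x; rewrite -(strict_limit_thread _ nm).
Qed.

(** The topology is that of the seminorms [|p n x|]. Each is bounded by a multiple of any later one,
    so a single index suffices. *)
Lemma strict_limit_nbhsP x (A : set E) : nbhs x A <->
  exists n, exists2 e : R, 0 < e & [set y | `|p n (y - x)| < e] `<=` A.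
Proof.
split; last first.
  move=> [n [e e0 eA]]; apply: filterS eA _.
  have -> : [set y | `|p n (y - x)| < e] = p n @^-1` ball (p n x) e.
    by apply/seteqP; split=> y /=; rewrite -ball_normE /ball_/= linearB distrC.
  by apply: strict_limit_continuous; exact: nbhsx_ballx.
pose G : set_system E := [set B | exists n, exists2 e : R, 0 < e &
  [set y | `|p n (y - x)| < e] `<=` B].
have FG : Filter G.
  split.
  - by exists 0%N, 1.
  - move=> B C [n [e e0 eB]] [m [d d0 dC]].
    have [K K0 nK] := norm_le (leq_maxl n m).
    have [L L0 mL] := norm_le (leq_maxr n m).
    exists (maxn n m), (Num.min (e / K) (d / L)).
      by rewrite lt_min !divr_gt0.
    move=> y /=; rewrite lt_min => /andP[yK yL]; split.
      by apply: eB; rewrite /= (le_lt_trans (nK _))// mulrC -ltr_pdivlMr.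
    by apply: dC; rewrite /= (le_lt_trans (mL _))// mulrC -ltr_pdivlMr.
  - by move=> B C BC [n [e e0 eB]]; exists n, e => // y /eB /BC.
rewrite nbhsE => -[A' [oA' A'x] A'A].
suff : G A' by move=> [n [e e0 eA']]; exists n, e => // y /eA' /A'A.
have [[_ _ topE] _] := hEP; have [B oB AB] := (topE A').1 oA'; subst A'.
pose iota : E -> prod_topology F := fun y n => p n y.
(* Convergence of [iota] along [G] puts the preimage of [B] in [G], and it can be tested one
   coordinate at a time. *)
suff : iota @ G --> (iota x : prod_topology F).
  by apply; apply: open_nbhs_nbhs.
apply/cvg_sup => n U [V] [[W] oW <-] Wx WU.
apply: (filterS WU).
have /nbhs_ballP[e e0 eW] : nbhs (p n x) W by exact: open_nbhs_nbhs.
exists n, e => // y ye; apply: eW.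
by rewrite -ball_normE /ball_/= distrC -linearB.
Qed.

(** As the [C m] do not depend on [y], this one lift gives both the openness of [p n] and the
    lifting of bounded sets. *)
Lemma strict_limit_lift n : exists C : nat -> R, (forall m, 0 < C m) /\
  forall y, exists x, p n x = y /\ forall m, `|p m x| <= C m * `|y|.
Proof.
have [cP Pid PP] := hP.
have om m : {Ks : R * (F m -> F m.+1) | 0 < Ks.1 /\
    forall y, P m m.+1 (Ks.2 y) = y /\ `|Ks.2 y| <= Ks.1 * `|y|}.
  apply: cid.
  have [|K K0 TK] := open_mapping (cP m m.+1 (leqnSn m)).
    move=> y; have [x xy] := strict_limit_surj y.
    by exists (p m.+1 x); rewrite strict_limit_thread.
  have /choice[t tP] y : exists x, P m m.+1 x = y /\ `|x| <= K * `|y|.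
    by have [x] := TK y; exists x.
  by exists (K, t).
pose s m := (sval (om m)).2.
have sP m y : P m m.+1 (s m y) = y := (((svalP (om m)).2) y).1.
(* Up to index [n] the coordinates are forced by [y]; beyond it, each comes from the previous one by
   the norm-controlled section [s]. *)
pose z y := fix z m : F m := match m return F m with
  | 0 => P 0%N n y
  | m'.+1 => if (m'.+1 <= n)%N then P m'.+1 n y else s m' (z m')
  end.
have zE y m : (m <= n)%N -> z y m = P m n y by case: m => //= m ->.
have zS y m : P m m.+1 (z y m.+1) = z y m.
  by rewrite /=; case: ifPn => mn; [rewrite PP// zE// ltnW|exact: sP].
have zP y i j : (i <= j)%N -> P i j (z y j) = z y i.
  elim: j => [|j IHj]; first by rewrite leqn0 => /eqP ->.
  rewrite leq_eqVlt ltnS => /predU1P[->//|ij].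
  by rewrite -(PP _ _ _ ij (leqnSn j)) zS IHj.
have /choice[C CP] m : exists c : R, 0 < c /\ forall y, `|z y m| <= c * `|y|.
  have Pc k : (k <= n)%N -> exists c : R, 0 < c /\ forall y, `|P k n y| <= c * `|y|.
    by move=> /cP /continuous_linear_norm_le[c ? ?]; exists c.
  elim: m => [|m [c [c0 zc]]]; first exact: Pc.
  have [mn|/negbTE mn] := boolP (m.+1 <= n)%N.
    by have [d [d0 dP]] := Pc _ mn; exists d; split=> // y; rewrite /= mn.
  have [K0 sK] := svalP (om m).
  exists ((sval (om m)).1 * c); split; first exact: mulr_gt0.
  by move=> y; rewrite /= mn (le_trans (sK _).2)// -mulrA ler_pM2l.
exists C; split=> [m|y]; first by have [] := CP m.
have [x xz] := strict_limit_ex (zP y).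
exists x; split=> [|m]; rewrite xz; last exact: (CP m).2.
by rewrite zE// Pid.
Qed.

Lemma strict_limit_open n (U : set E) : open U -> open (p n @` U).
Proof.
move=> oU; rewrite openE => _ [x Ux <-].
have /strict_limit_nbhsP[m [e e0 eU]] : nbhs x U by exact: open_nbhs_nbhs.
have [C [C0 lift]] := strict_limit_lift n.
apply/nbhs_ballP; exists (e / C m) => [|y]; first exact: divr_gt0.
rewrite -ball_normE /ball_/= distrC ltr_pdivlMr// mulrC => ye.
have [v [vy vC]] := lift (y - p n x).
exists (x + v); last by rewrite linearD vy addrC subrK.
by apply: eU; rewrite /= [x + v]addrC addrK (le_lt_trans (vC m)).
Qed.

(** Stage [k] controls the first [k + 1] seminorms at once, so along a sequence of stages the sets
    become small for every seminorm. *)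
Definition strict_limit_small (k : nat) (U : set E) := forall i x y,
  (i <= k)%N -> U x -> U y -> `|p i (x - y)| < k.+1%:R^-1.

Lemma strict_limit_sieve : tvs_complete E -> complete_sieve strict_limit_small.
Proof.
move=> complE; split=> [k W x oW Wx|u su u0 clu].
  pose e1 : R := k.+1%:R^-1 / 2.
  have e10 : 0 < e1 by rewrite divr_gt0.
  have : nbhs x (W `&` [set z | forall i : 'I_k.+1, `|p i (z - x)| < e1]).
    apply: filterI; first exact: open_nbhs_nbhs.
    by apply: filter_forall => i; apply/strict_limit_nbhsP; exists (nat_of_ord i), e1.
  move=> /strict_limit_nbhsP[n [e e0 eW]].
  have e20 : 0 < e / 2 by rewrite divr_gt0.
  (* Half the radius, so that the closure of [U] stays in the ball of radius [e]. *)
  pose U := [set z | `|p n (z - x)| < e / 2].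
  have UW : closure U `<=` [set y | `|p n (y - x)| < e].
    move=> z clUz; have [|t [Ut zt]] := clUz [set y | `|p n (y - z)| < e / 2].
      by apply/strict_limit_nbhsP; exists n, (e / 2).
    rewrite /= -(subrK t z) -addrA linearD (le_lt_trans (ler_normD _ _))//.
    by rewrite [ltRHS]splitr ltrD// -opprB linearN normrN.
  exists U; split.
  - have -> : U = p n @^-1` ball (p n x) (e / 2).
      by apply/seteqP; split=> y /=; rewrite /U -ball_normE /ball_/= linearB distrC.
    by apply: open_comp => [y _|]; [exact: strict_limit_continuous|exact: ball_open].
  - by rewrite /U /= subrr linear0 normr0.
  - by move=> z /UW /eW[].
  - move=> i z t ik Uz Ut.
    have /eW[_ /(_ (inord i))/=] := UW _ (subset_closure Uz).
    have /eW[_ /(_ (inord i))/=] := UW _ (subset_closure Ut).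
    rewrite inordK ?ltnS// => te ze.
    rewrite -(subrK x z) -addrA linearD (le_lt_trans (ler_normD _ _))//.
    by rewrite [ltRHS]splitr ltrD// -opprB linearN normrN.
have usub i j : (i <= j)%N -> u j `<=` u i.
  elim: j => [|j IHj]; first by rewrite leqn0 => /eqP ->.
  rewrite leq_eqVlt ltnS => /predU1P[->//|/IHj ji] x ujx.
  by apply: ji; apply: clu; exact: subset_closure.
have usmall n (e : R) : 0 < e -> exists k, (n <= k)%N /\ k.+1%:R^-1 < e.
  move=> e0; exists (maxn n (Num.truncn e^-1)); split; first exact: leq_maxl.
  rewrite -ltf_pV2 ?posrE ?invr_gt0// invrK.
  by rewrite (lt_le_trans (truncnS_gt _))// ler_nat ltnS leq_maxr.
have /choice[c cu] k : exists x, u k x := u0 k.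
(* Points picked in the nested [u k] form a Cauchy sequence; its limit lies in the closure of each
   [u k.+1], hence in [u k]. *)
have [|x cx] := complE (c @ \oo) _.
  move=> U /strict_limit_nbhsP[n [e e0 eU]].
  have [k [nk ke]] := usmall n e e0.
  exists (u k).
    by exists k => // j /= kj; apply: (usub _ _ kj).
  move=> x y ux uy; apply: eU; rewrite /= subr0.
  exact: lt_trans (su _ _ _ _ nk ux uy) ke.
have ux k : u k x.
  apply: clu => N /cx [j _ jN]; exists (c (maxn j k.+1)); split.
    by apply: (usub _ _ (leq_maxr j k.+1)).
  by apply: jN; exact: leq_maxl.
exists x => // N /strict_limit_nbhsP[n [e e0 eN]].
have [k [nk ke]] := usmall n e e0.
exists k => y uy; apply: eN; exact: lt_trans (su _ _ _ _ nk uy (ux k)) ke.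
Qed.

End quojection.
(** * Differentiability through a linear map *)

(** Uniformity in [w] makes the difference quotients of [f] and [g] agree on a whole bounded set for
    the same [t], as Fréchet differentiability demands. *)
Lemma near_dnbhs_scale (R : realType) (W : normedModType R) (a : W) (V : set W) (C : R) :
  nbhs a V -> \forall t \near (0 : R)^', forall w, `|w| <= C -> V (a + t *: w).
Proof.
move=> /nbhs_ballP[e e0 eV].
have C0 : 0 < `|C| + 1 by rewrite ltr_wpDl.
near=> t => w wC; apply: eV; rewrite -ball_normE /ball_/= opprD addrA subrr sub0r normrN.
rewrite normrZ (@le_lt_trans _ _ (`|t| * (`|C| + 1)))//.
  by rewrite ler_wpM2l// (le_trans wC)// (le_trans (ler_norm C))// lerDl.
rewrite -ltr_pdivlMr//; near: t; apply: dnbhs0_lt; exact: divr_gt0.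
Unshelve. all: by end_near. Qed.

Section differentiability.
Context {R : realType} {E : tvsType R} {W : normedModType R} {p : {linear E -> W}}.
Hypothesis cp : continuous p.

Lemma tvs_bounded_norm_le (B : set E) :
  tvs_bounded B -> exists C : R, forall y, B y -> `|p y| <= C.
Proof.
move=> /(_ (p @^-1` ball 0 1)) [|r r0 rB].
  by apply: cp; rewrite linear0; exact: nbhsx_ballx.
exists (r + 1) => y /(rB (r + 1) _)[|z]; first by rewrite ltrDl.
rewrite /= -ball_normE /ball_/= sub0r normrN => z1 <-.
by rewrite linearZ normrZ gtr0_norm ?ler_piMr// ?ltW// addr_gt0.
Qed.

Section factor.
Variables (g : W -> R^o) (f : E -> R^o) (x : E) (V : set W).
Hypotheses (Vx : nbhs (p x) V) (fg : forall z, V (p z) -> f z = g (p z)).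

Let near_quotient (B : set E) (C : R) : (forall y, B y -> `|p y| <= C) ->
  \forall t \near (0 : R)^', forall y, B y ->
    (f (x + t *: y) - f x) / t = (g (p x + t *: p y) - g (p x)) / t.
Proof.
move=> BC; apply: filterS (near_dnbhs_scale C Vx) => t tV y By.
rewrite !fg ?linearD ?linearZ//; first exact: nbhs_singleton Vx.
by apply: tV; exact: BC.
Qed.

Let gateaux_derivative_factor (xs : {linear W -> R^o}) :
  gateaux_derivative g (p x) xs -> gateaux_derivative f x (xs \o p).
Proof.
move=> [cxs gxs]; split=> [z|y]; first by apply: continuous_comp; [exact: cp|exact: cxs].
apply: cvg_trans (gxs (p y)); apply: near_eq_cvg.
have [|] := @near_quotient [set y] `|p y|; first by move=> _ ->.
move=> e e0 near_t; exists e => // t te t0; rewrite near_t//.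
Qed.

Lemma gateaux_differentiable_factor :
  gateaux_differentiable g (p x) -> gateaux_differentiable f x.
Proof. by move=> [xs gxs]; exists (xs \o p); exact: gateaux_derivative_factor. Qed.

Lemma frechet_differentiable_factor :
  frechet_differentiable g (p x) -> frechet_differentiable f x.
Proof.
move=> [xs [gxs unif]]; exists (xs \o p); split=> [|B bB e e0].
  exact: gateaux_derivative_factor.
have [C BC] := tvs_bounded_norm_le bB.
have bpB : tvs_bounded (p @` B).
  move=> U U0; have [|r r0 rB] := bB (p @^-1` U).
    by apply: cp; rewrite linear0.
  exists r => // t rt _ [y By <-].
  by have [z Uz <-] := rB t rt y By; exists (p z) => //; rewrite linearZ.
near=> t => y By.
rewrite (near (near_quotient BC) t)//=.
by apply: (near (unif _ bpB e e0) t) => //; exists y.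
Unshelve. all: by end_near. Qed.

End factor.

Section descend.
Hypotheses (op : forall U, open U -> open (p @` U)) (surj : forall w, exists x, p x = w).
Variables (g : W -> R^o) (x : E).

(** Since [g \o p] is constant along the kernel of [p], its derivative vanishes there and factors
    through [p]; openness of [p] makes the factor continuous. *)
Let gateaux_derivative_descend (xs : {linear E -> R^o}) :
  gateaux_derivative (g \o p) x xs ->
  exists2 ys : {linear W -> R^o}, gateaux_derivative g (p x) ys & forall z, ys (p z) = xs z.
Proof.
move=> [cxs gxs].
have ker z : p z = 0 -> xs z = 0.
  move=> pz; apply/esym/(cvg_unique (@norm_hausdorff _ _) _ (gxs z)).
  rewrite (_ : (fun t => _) = cst 0); first exact: cvg_cst.
  by apply/funext => t /=; rewrite linearD linearZ/= pz scaler0 addr0 subrr mul0r.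
have /choice[s ps] := surj.
have xsE u v : p u = p v -> xs u = xs v.
  by move=> uv; apply/eqP; rewrite -subr_eq0 -linearB ker// linearB uv subrr.
have lys : linear (xs \o s : W -> R^o).
  by move=> a u v /=; rewrite -linearP; apply: xsE; rewrite linearP !ps.
pose ys : {linear W -> R^o} :=
  HB.pack (xs \o s : W -> R^o) (GRing.isLinear.Build _ _ _ _ _ lys).
exists ys; last by move=> z; apply: xsE; rewrite ps.
split=> [|y].
  apply/continuousP => A oA.
  rewrite (_ : ys @^-1` A = p @` (xs @^-1` A)); last first.
    apply/seteqP; split=> [w Aw|_ [z Az <-]]; first by exists (s w).
    by rewrite /preimage/= /ys /= (@xsE _ z) ?ps.
  by apply: op; apply: open_comp.
have := gxs (s y); rewrite (_ : (fun t => _) = (fun t => (g (p x + t *: y) - g (p x)) / t))//.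
by apply/funext => t /=; rewrite linearD linearZ ps.
Qed.

Lemma gateaux_differentiable_descend :
  gateaux_differentiable (g \o p) x -> gateaux_differentiable g (p x).
Proof. by move=> [xs /gateaux_derivative_descend[ys gys _]]; exists ys. Qed.

Lemma frechet_differentiable_descend :
  (forall B, tvs_bounded B -> exists2 B', tvs_bounded B' & B `<=` p @` B') ->
  frechet_differentiable (g \o p) x -> frechet_differentiable g (p x).
Proof.
move=> lift [xs [/gateaux_derivative_descend[ys gys ysE] unif]].
exists ys; split=> // B /lift[B' bB' BB'] e e0.
apply: filterS (unif _ bB' e e0) => t tB y /BB'[z B'z <-].
by rewrite ysE; have := tB z B'z; rewrite /= linearD linearZ.
Qed.

End descend.

End differentiability.
(** * Local factorization of convex functions *)

Section convexity.
Context {R : realType} {M : lmodType R}.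

Lemma convex_setP (D : set M) : convex_set D <->
  forall x y (t : R), D x -> D y -> 0 <= t <= 1 -> D (t *: x + (1 - t) *: y).
Proof.
split=> [cD x y t Dx Dy /andP[t0 t1]|cD x y t].
  by have := cD x y (Itv01 t0 t1) (mem_set Dx) (mem_set Dy) => /set_mem.
by rewrite !inE => Dx Dy; apply: (cD x y t%:num) => //; rewrite ge0 le1.
Qed.

Lemma convex_functionP (D : set M) (f : M -> R^o) : convex_function D f <->
  forall x y (t : R), D x -> D y -> 0 <= t <= 1 ->
    f (t *: x + (1 - t) *: y) <= t * f x + (1 - t) * f y.
Proof.
split=> [cD x y t Dx Dy /andP[t0 t1]|cD t x y].
  exact: (cD (Itv01 t0 t1) x y (mem_set Dx) (mem_set Dy)).
by rewrite !inE => Dx Dy; apply: (cD x y t%:num) => //; rewrite ge0 le1.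
Qed.

(* Along a line contained in the fibre, a convex function bounded above is
   constant. *)
Lemma convex_function_fiber (N : lmodType R) (q : {linear M -> N}) (V : set N)
    (f : M -> R^o) (K : R) :
  convex_function (q @^-1` V) f -> (forall z, V (q z) -> f z <= K) ->
  forall a b, V (q a) -> q a = q b -> f a = f b.
Proof.
move=> /convex_functionP cf fK.
suff le a b : V (q a) -> q a = q b -> f b <= f a.
  by move=> a b Va ab; apply/le_anti; rewrite !le// -ab.
move=> Va ab; rewrite leNgt; apply/negP => fab.
(* [b] lies on the segment from [a] to [c], a point of the same fibre that recedes as [t] tends to 0
   while [f c] stays at most [K]. *)
have line (t : R) : 0 < t <= 1 -> f b <= (1 - t) * f a + t * K.
  move=> /andP[t0 t1]; pose c := a + t^-1 *: (b - a).
  have Vc : V (q c) by rewrite linearD linearZ/= linearB ab subrr scaler0 addr0 -ab.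
  have -> : b = t *: c + (1 - t) *: a.
    rewrite /c scalerDr scalerA divff ?gt_eqF// scale1r scalerBl scale1r.
    by rewrite [t *: a + _]addrC -addrA [t *: a + _]addrC !subrK.
  have := cf _ _ t Vc Va; rewrite (ltW t0) t1 => /(_ isT)/le_trans; apply.
  by rewrite addrC lerD2l ler_pM2l// fK.
have d0 : 0 < f b - f a by rewrite subr_gt0.
have Kd : f b - f a <= K - f a by rewrite lerD2r fK// -ab.
have K0 : 0 < K - f a by exact: lt_le_trans Kd.
(* This [t] puts the bound halfway between [f a] and [f b], hence below [f b]. *)
have := line ((f b - f a) / (K - f a) / 2).
rewrite !divr_gt0//= ler_pdivrMr// ler_pdivrMr// mul1r.
have -> : (1 - (f b - f a) / (K - f a) / 2) * f a + (f b - f a) / (K - f a) / 2 * K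
  = f a + (f b - f a) / 2 by field; rewrite gt_eqF.
by move=> H; have := H ltac:(lra); lra.
Qed.

End convexity.

(** * Transfer of generic differentiability between the limit and its factors *)

Lemma generic_subset (T : topologicalType) (D S S' : set T) :
  (forall x, D x -> S x -> S' x) -> generic D S -> generic D S'.
Proof.
move=> SS' [G [GD ? ? GS]]; exists G; split=> // x Gx.
by apply: SS'; [exact: GD|exact: GS].
Qed.

Lemma within_open_continuousP (T U : topologicalType) (D : set T) (f : T -> U) :
  open D -> {within D, continuous f} <-> forall x, D x -> {for x, continuous f}.
Proof.
move=> oD; rewrite continuous_open_subspace//.
by split=> [cf x /mem_set /cf|cf x /set_mem /cf].
Qed.

Section quojection_generic.
Context {R : realType} {E : tvsType R} {F : nat -> completeNormedModType R}.
Context {P : forall n m : nat, {linear F m -> F n}}.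
Context {p : forall n : nat, {linear E -> F n}}.
Hypotheses (hP : projective_system P) (hEP : strict_projective_limit P p).

(** A bound prescribed for each seminorm defines a bounded set, and the lifts of [strict_limit_lift]
    obey such bounds. *)
Lemma strict_limit_bounded_lift n (B : set (F n)) : tvs_bounded B ->
  exists2 B', tvs_bounded B' & B `<=` p n @` B'.
Proof.
move=> bB; have [K BK] : exists K : R, forall y, B y -> `|y| <= K.
  have cid : continuous (@idfun (F n)) by move=> y; exact: cvg_id.
  exact: (tvs_bounded_norm_le (p := idfun) cid bB).
have [C [C0 lift]] := strict_limit_lift hP hEP n.
exists [set x | forall m, `|p m x| <= C m * `|K|].
  move=> U /(strict_limit_nbhsP hP hEP)[m [e e0 eU]].
  exists (C m * `|K| / e + 1) => [|t tr y /(_ m) yC].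
    by rewrite ltr_wpDl// divr_ge0// ?mulr_ge0// ltW.
  have tK : C m * `|K| / e < t by rewrite (le_lt_trans _ tr)// lerDl.
  have t0 : 0 < t by rewrite (le_lt_trans _ tK)// divr_ge0// ?mulr_ge0// ltW.
  exists (t^-1 *: y); last by rewrite scalerA divff ?scale1r// gt_eqF.
  apply: eU; rewrite /= subr0 linearZ normrZ gtr0_norm ?invr_gt0//.
  by rewrite mulrC ltr_pdivrMr// (le_lt_trans yC)// [e * t]mulrC -ltr_pdivrMr.
move=> y By; have [x [xy xC]] := lift y; exists x => //= m.
by rewrite (le_trans (xC m))// ler_pM2l ?C0//; exact: le_trans (BK _ By) (ler_norm _).
Qed.

(** The abstract [diffE] and [diffF] serve both notions of differentiability. Genericity is local,
    so near each point it is pulled back from some [F n]. *)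
Lemma generically_in_limit (diffE : (E -> R^o) -> E -> Prop)
    (diffF : forall n, (F n -> R^o) -> F n -> Prop) :
  (forall n g f x V, nbhs (p n x) V -> (forall z, V (p n z) -> f z = g (p n z)) ->
    diffF n g (p n x) -> diffE f x) ->
  (forall n, generically_in (diffF n)) -> generically_in diffE.
Proof.
move=> factor genF D f D0 oD cD /(within_open_continuousP _ oD) cf convf.
apply: generic_local => x Dx.
have /(strict_limit_nbhsP hP hEP)[n [e e0 eW]] : nbhs x (D `&` [set z | f z < f x + 1]).
  apply: filterI; first exact: open_nbhs_nbhs.
  apply: (cf x Dx [set r | r < f x + 1]).
  by apply: open_nbhs_nbhs; split; [exact: open_lt|rewrite /= ltrDl].
pose V : set (F n) := ball (p n x) e.
have {}eW z : V (p n z) -> D z /\ f z <= f x + 1.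
  by rewrite /V -ball_normE /ball_/= distrC -linearB => /eW[? /ltW].
(* [s] is an arbitrary section, with no linearity or continuity; constancy of [f] on the fibres
   makes [g] independent of it on [V]. *)
have /choice[s ps] := strict_limit_surj hEP (n := n).
pose g : F n -> R^o := f \o s.
have convV : convex_function (p n @^-1` V) f.
  apply/convex_functionP => a b t /eW[Da _] /eW[Db _]; exact: (convex_functionP D f).1.
have fg z : V (p n z) -> f z = g (p n z).
  move=> Vz.
  exact: (convex_function_fiber convV (fun z Vz => (eW z Vz).2) Vz (esym (ps _))).
have oV : open V by exact: ball_open.
have cV : convex_set V.
  apply/convex_setP => a b t; rewrite /V -!ball_normE /ball_/= => xa xb /andP[t0 t1].
  have -> : p n x - (t *: a + (1 - t) *: b) = t *: (p n x - a) + (1 - t) *: (p n x - b).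
    by rewrite !scalerBr addrACA -opprD -scalerDl addrC [t + _]addrC subrK scale1r addrC.
  rewrite (le_lt_trans (ler_normD _ _))// !normrZ !ger0_norm ?subr_ge0//.
  have -> : e = t * e + (1 - t) * e by rewrite -mulrDl addrC subrK mul1r.
  have [->|tn0] := eqVneq t 0; first by rewrite !mul0r !add0r subr0 !mul1r.
  apply: ltr_leD; first by rewrite ltr_pM2l// lt_neqAle eq_sym tn0.
  by rewrite ler_wpM2l ?subr_ge0// ltW.
exists (p n @^-1` V); split.
- by apply: open_comp => // z _; exact: strict_limit_continuous hEP _ _.
- exact: ballxx.
- by move=> z /eW[].
apply: (@generic_subset _ _ (p n @^-1` (diffF n g))).
  by move=> z Vz; apply: (factor n g f z V) => //; exact: open_nbhs_nbhs.
apply: (@generic_preimage E (F n) (p n)).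
- exact: strict_limit_continuous hEP _.
- exact: (@strict_limit_open _ _ _ _ _ hP hEP n).
apply: genF => //; first by exists (p n x); exact: ballxx.
(* Continuity of [g] comes from openness of [p n]: neighbourhoods of [s v] have neighbourhoods of
   [v] as images. *)
- apply/within_open_continuousP => // v Vv A Ag.
  have Vs : V (p n (s v)) by rewrite ps.
  have : nbhs (s v) (f @^-1` A `&` p n @^-1` V).
    apply: filterI; first by apply: cf => //; have [] := eW _ Vs.
    by apply: open_nbhs_nbhs; split => //; apply: open_comp => // z _;
      exact: strict_limit_continuous hEP _ _.
  rewrite nbhsE => -[U [oU Us] UA].
  have : nbhs v (p n @` U).
    apply: open_nbhs_nbhs; split; first exact: (strict_limit_open hP hEP).
    by exists (s v).
  by apply: filterS => _ [z /UA[Az Vz] <-]; rewrite /= -fg.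
- apply/convex_functionP => a b t Va Vb t01.
  have Vsa : V (p n (s a)) by rewrite ps.
  have Vsb : V (p n (s b)) by rewrite ps.
  have pE : t *: a + (1 - t) *: b = p n (t *: s a + (1 - t) *: s b).
    by rewrite linearD !linearZ/= !ps.
  rewrite pE -fg; first exact: (convex_functionP _ _).1 convV _ _ _ Vsa Vsb t01.
  by rewrite -pE; exact: (convex_setP V).1.
Qed.

(** Convexity and continuity pass to [g \o p n], and its differentiability points lie over those of
    [g]; completeness of [E] then lets [generic_image] apply. *)
Lemma generically_in_factor n (diffE : (E -> R^o) -> E -> Prop)
    (diffF : (F n -> R^o) -> F n -> Prop) :
  tvs_complete E ->
  (forall g x, diffE (g \o p n) x -> diffF g (p n x)) ->
  generically_in diffE -> generically_in diffF.
Proof.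
move=> complE descend genE D g [y0 Dy0] oD cD /(within_open_continuousP _ oD) cg convg.
have surj := strict_limit_surj hEP (n := n).
have cp := strict_limit_continuous hEP (n := n).
have op := @strict_limit_open _ _ _ _ _ hP hEP n.
have sieve := strict_limit_sieve hP hEP complE.
apply: (@generic_image E (F n) (p n) _ cp op sieve D oD _
  (@norm_hausdorff _ _) (@Baire _ _) surj).
have oD' : open (p n @^-1` D) by apply: open_comp.
apply: (@generic_subset _ _ (diffE (g \o p n))); first by move=> x _; exact: descend.
apply: genE => //.
- by have [x xy] := surj y0; exists x; rewrite /= xy.
- apply/convex_setP => a b t Da Db t01 /=.
  by rewrite linearD !linearZ/=; exact: (convex_setP D).1.
- apply/within_open_continuousP => // x Dx.
  by apply: continuous_comp; [exact: cp|exact: cg].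
- apply/convex_functionP => a b t Da Db t01 /=.
  by rewrite linearD !linearZ/=; exact: (convex_functionP D g).1.
Qed.

End quojection_generic.

Theorem theorem6p2 (R : realType) (E : tvsType R)
    (F : nat -> completeNormedModType R)
    (P : forall n m : nat, {linear F m -> F n})
    (p : forall n : nat, {linear E -> F n})
    (hE : frechet_space E)
    (hP : projective_system P)
    (hEP : strict_projective_limit P p) :
  (asplund E <-> forall n : nat, asplund (F n)) /\
  (weak_asplund E <-> forall n : nat, weak_asplund (F n)).
Proof.
have [_ complE] := hE.
have surj n := strict_limit_surj hEP (n := n).
have cp n := strict_limit_continuous hEP (n := n).
have op n := @strict_limit_open _ _ _ _ _ hP hEP n.
split; split=> [genE n|genF].
- apply: (generically_in_factor hP hEP complE _ genE) => g x.
  apply: (frechet_differentiable_descend (op n) (surj n)).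
  exact: (@strict_limit_bounded_lift _ _ _ _ _ hP hEP n).
- apply: (generically_in_limit hP hEP _ genF) => n g f x V Vx fg.
  exact: (frechet_differentiable_factor (cp n) Vx fg).
- apply: (generically_in_factor hP hEP complE _ genE) => g x.
  exact: (gateaux_differentiable_descend (op n) (surj n)).
- apply: (generically_in_limit hP hEP _ genF) => n g f x V Vx fg.
  exact: (gateaux_differentiable_factor (cp n) Vx fg).
Qed.
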